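(* Let $\mu$ be the Möbius function. Then the power series $\sum_{n=1}^\infty \mu(n)z^n\in \mathbb{Z}[[z]]$ is transcendental over $\mathbb{Z}[z]$.
   Context: The Möbius function $\mu$ is defined on positive integers by $\mu(n)=0$ if $p^2\mid n$ for some prime $p$, and $\mu(n)=(-1)^k$ if $n$ is a product of $k$ distinct primes (so $\mu(1)=1$). A power series $F(z)\in\mathbb{Z}[[z]]$ is transcendental over $\mathbb{Z}[z]$ if there is no nonzero polynomial $P(y)=a_d(z)y^d+\cdots+a_1(z)y+a_0(z)$ with coefficients $a_i(z)\in\mathbb{Z}[z]$ such that $P(F(z))=0$ in $\mathbb{Z}[[z]]$. *)

(* Defs.v *)
(* MathComp, with the classical choice structures of mathcomp.classical. *)
From HB Require Import structures.
From mathcomp Require Import all_boot all_order all_algebra.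
From mathcomp Require Import boolp.

Set Implicit Arguments.
Unset Strict Implicit.
Unset Printing Implicit Defensive.

Import GRing.Theory.
Local Open Scope ring_scope.

(* A record rather than [nat -> R], whose ring structure in mathcomp.classical
   is the pointwise one. *)
Record fps (R : Type) := Fps { coefs : nat -> R }.

Lemma fpsP (R : Type) (F G : fps R) : coefs F =1 coefs G -> F = G.
Proof. by case: F G => [f] [g] /= /funext ->. Qed.

HB.instance Definition _ (R : Type) := gen_eqMixin (fps R).
HB.instance Definition _ (R : Type) := gen_choiceMixin (fps R).

Section FpsRing.
Variable R : comNzRingType.
Implicit Types F G H : fps R.

Definition fps_of_poly (p : {poly R}) : fps R := Fps (fun n => p`_n).

Definition fps_zero : fps R := Fps (fun=> 0).
Definition fps_one : fps R := Fps (fun n => (n == 0%N)%:R).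
Definition fps_opp F : fps R := Fps (fun n => - coefs F n).
Definition fps_add F G : fps R := Fps (fun n => coefs F n + coefs G n).
Definition fps_mul F G : fps R :=
  Fps (fun n => \sum_(i < n.+1) coefs F i * coefs G (n - i)%N).

Fact fps_addA : associative fps_add.
Proof. by move=> F G H; apply: fpsP => n /=; rewrite addrA. Qed.
Fact fps_addC : commutative fps_add.
Proof. by move=> F G; apply: fpsP => n /=; rewrite addrC. Qed.
Fact fps_add0 : left_id fps_zero fps_add.
Proof. by move=> F; apply: fpsP => n /=; rewrite add0r. Qed.
Fact fps_addN : left_inverse fps_zero fps_opp fps_add.
Proof. by move=> F; apply: fpsP => n /=; rewrite addNr. Qed.

HB.instance Definition _ :=
  GRing.isZmodule.Build (fps R) fps_addA fps_addC fps_add0 fps_addN.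

Definition fps_trunc (m : nat) F : {poly R} := \poly_(i < m) coefs F i.

Lemma coefs_mul_trunc F G (p q : {poly R}) n :
    (forall i, (i <= n)%N -> p`_i = coefs F i) ->
    (forall i, (i <= n)%N -> q`_i = coefs G i) ->
  coefs (fps_mul F G) n = (p * q)`_n.
Proof.
move=> pF qG; rewrite coefM; apply: eq_bigr => i _.
by rewrite pF ?qG ?leq_subr // -ltnS.
Qed.

Lemma coef_fps_trunc m F i : (i < m)%N -> (fps_trunc m F)`_i = coefs F i.
Proof. by move=> lt_im; rewrite coef_poly lt_im. Qed.

Fact fps_mulA : associative fps_mul.
Proof.
move=> F G H; apply: fpsP => n; pose t := fps_trunc n.+1.
have tE K i : (i <= n)%N -> (t K)`_i = coefs K i.
  by move=> le_in; rewrite coef_fps_trunc.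
have tM K L i : (i <= n)%N -> (t K * t L)`_i = coefs (fps_mul K L) i.
  by move=> le_in; rewrite (@coefs_mul_trunc K L (t K) (t L)) // => j le_ji;
     rewrite tE // (leq_trans le_ji).
rewrite (coefs_mul_trunc (tE F) (tM G H)) (coefs_mul_trunc (tM F G) (tE H)).
by rewrite mulrA.
Qed.

Fact fps_mulC : commutative fps_mul.
Proof.
move=> F G; apply: fpsP => n.
have tE K i : (i <= n)%N -> (fps_trunc n.+1 K)`_i = coefs K i.
  by move=> le_in; rewrite coef_fps_trunc.
by rewrite (coefs_mul_trunc (tE F) (tE G)) (coefs_mul_trunc (tE G) (tE F)) mulrC.
Qed.

Fact fps_mul1 : left_id fps_one fps_mul.
Proof.
move=> F; apply: fpsP => n /=.
by rewrite big_ord_recl /= mul1r subn0 big1 ?addr0 // => i _; rewrite mul0r.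
Qed.

Fact fps_mulDl : left_distributive fps_mul fps_add.
Proof.
move=> F G H; apply: fpsP => n /=.
by rewrite -big_split; apply: eq_bigr => i _ /=; rewrite mulrDl.
Qed.

Fact fps_one_neq0 : fps_one != 0.
Proof.
by apply/eqP => /(congr1 (fun F => coefs F 0%N))/eqP; rewrite /= oner_eq0.
Qed.

HB.instance Definition _ := GRing.Zmodule_isComNzRing.Build (fps R)
  fps_mulA fps_mulC fps_mul1 fps_mulDl fps_one_neq0.

Fact fps_of_poly_is_zmod_morphism : zmod_morphism fps_of_poly.
Proof. by move=> p q; apply: fpsP => n /=; rewrite coefB. Qed.

Fact fps_of_poly_is_monoid_morphism : monoid_morphism fps_of_poly.
Proof.
split=> [|p q]; apply: fpsP => n /=; first by rewrite coef1.
by rewrite coefM.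
Qed.

HB.instance Definition _ := GRing.isZmodMorphism.Build {poly R} (fps R)
  fps_of_poly fps_of_poly_is_zmod_morphism.
HB.instance Definition _ := GRing.isMonoidMorphism.Build {poly R} (fps R)
  fps_of_poly fps_of_poly_is_monoid_morphism.

Lemma fps_of_poly_inj : injective fps_of_poly.
Proof.
move=> p q eq_pq; apply/polyP => n.
exact: (congr1 (fun F => coefs F n) eq_pq).
Qed.

End FpsRing.

(* [algebraicOver] of mxpoly is only available over a field. *)
Definition transcendentalOver (R S : nzRingType) (RtoS : R -> S) (u : S) :=
  forall P : {poly R}, P != 0 -> ~ root (map_poly RtoS P) u.

(* The value at 0 is irrelevant. *)
Definition moebius (n : nat) : int :=
  if has (fun p => p ^ 2 %| n)%N (primes n) then 0
  else (-1) ^+ size (primes n).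

Lemma moebius_sq (n p : nat) :
  (0 < n)%N -> prime p -> (p ^ 2 %| n)%N -> moebius n = 0.
Proof.
move=> n_gt0 pr_p p2n; rewrite /moebius ifT //; apply/hasP; exists p => //.
by rewrite mem_primes pr_p n_gt0 (dvdn_trans _ p2n) // dvdn_exp.
Qed.

Lemma moebius_prod (s : seq nat) :
  uniq s -> all prime s -> moebius (\prod_(p <- s) p)%N = (-1) ^+ size s.
Proof.
move=> s_uniq s_prime; set n := (\prod_(p <- s) p)%N.
have logn_s p : prime p -> logn p n = (p \in s).
  move=> pr_p; rewrite /n.
  elim: s s_uniq s_prime {n} => [|q s IHs] /=; first by rewrite big_nil logn1.
  case/andP=> qs s_uniq /andP[pr_q s_prime].
  have prod_gt0 : (0 < \prod_(r <- s) r)%N.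
    rewrite big_seq; apply: (big_ind (fun m => 0 < m)%N) => // [a b|r rs].
      by rewrite muln_gt0 => -> ->.
    by rewrite prime_gt0 // (allP s_prime).
  rewrite big_cons lognM ?(prime_gt0 pr_q) // IHs // logn_prime // inE.
  by case: eqVneq qs => [->|_ _]; [move/negPf-> | case: (p \in s)].
have primesE : primes n =i s.
  move=> p; rewrite -logn_gt0; have [pr_p|pr'p] := boolP (prime p).
    by rewrite logn_s // lt0b.
  rewrite lognE (negPf pr'p); apply/esym/negbTE.
  by apply: contra pr'p => /(allP s_prime).
rewrite (perm_size (uniq_perm s_uniq (primes_uniq n) (fsym primesE))).
rewrite /moebius ifF //; apply/hasP=> -[p].
rewrite mem_primes => /and3P[pr_p n_gt0 _].
by rewrite pfactor_dvdn // logn_s //; case: (p \in s).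
Qed.

Definition moebius_series : fps int :=
  Fps (fun n => if (0 < n)%N then moebius n else 0).

(* Main.v *)
Require Import Defs.
From HB Require Import structures.
From mathcomp Require Import all_boot all_order all_algebra.
From mathcomp Require Import boolp finfield zify ring lra.

(** The proof works modulo 2, where the Moebius series becomes the indicator
    series G of the squarefree numbers.

    An algebraic equation for the series over Z[z] can be divided by powers of
    2 until it has an odd coefficient ([root_reduction]), so G is algebraic over
    F_2[z].  If P annihilates G, any deg P + 1 of the powers y, y^2, y^4, y^8, ...
    are linearly dependent modulo P ([dependent_powers]), hence there are b_i in F_2[z], not all zero, with
    sum_i b_i G^(2^i) = 0.  Over F_2 one has G^(2^i) (z) = G (z^(2^i)), so the
    equation is a linear relation between coefficients of G: with g(m) the
    coefficient of z^m in G, for every n the sum of b_ij g((n - j) / 2^i), over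
    the pairs (i, j) with j <= n such that 2^i divides n - j, vanishes
    ([frobenius_relation]).

    Let i0 be the least i with b_i != 0, and let b_(i0, j0) be a nonzero
    coefficient of b_i0.  One chooses n for which exactly one term of this
    relation survives, which is absurd.  Take n = 2^i0 m + j0 with m odd and
    squarefree: the term (i0, j0) is nonzero, and the terms (i, j0) with i > i0
    do not occur because n - j0 is not divisible by 2^i.  If moreover n - j is
    divisible by the square of an odd prime p_j for each of the finitely many
    other relevant j, then (n - j) / 2^i is not squarefree and the
    corresponding terms are zero.  By the Chinese remainder theorem the
    conditions on m define an arithmetic progression whose residue is coprime to
    its modulus ([crt_residues]), and such a progression contains a squarefree
    number ([squarefree_in_progression]). *)

Set Implicit Arguments.
Unset Strict Implicit.
Unset Printing Implicit Defensive.

Import Order.TTheory GRing.Theory Num.Theory.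
Local Open Scope ring_scope.

(** * Change of coefficient ring for power series *)

Section PowerSeries.
Variables (R S : comNzRingType) (f : {rmorphism R -> S}).

Definition fps_map (F : fps R) : fps S := Fps (fun n => f (coefs F n)).

Fact fps_map_is_zmod_morphism : zmod_morphism fps_map.
Proof. by move=> F G; apply: fpsP => n /=; rewrite rmorphB. Qed.

Fact fps_map_is_monoid_morphism : monoid_morphism fps_map.
Proof.
split=> [|F G]; apply: fpsP => n /=; first by rewrite rmorph_nat.
by rewrite rmorph_sum; apply: eq_bigr => i _; rewrite rmorphM.
Qed.

HB.instance Definition _ := GRing.isZmodMorphism.Build (fps R) (fps S)
  fps_map fps_map_is_zmod_morphism.
HB.instance Definition _ := GRing.isMonoidMorphism.Build (fps R) (fps S)
  fps_map fps_map_is_monoid_morphism.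

Lemma fps_map_of_poly p : fps_map (fps_of_poly p) = fps_of_poly (map_poly f p).
Proof. by apply: fpsP => n /=; rewrite coef_map. Qed.

Lemma fps_map_root (P : {poly {poly R}}) F :
  root (map_poly (@fps_of_poly R) P) F ->
  root (map_poly (@fps_of_poly S) (map_poly (map_poly f) P)) (fps_map F).
Proof.
move=> /rootP PF0; apply/rootP.
rewrite -map_poly_comp (eq_map_poly (g := fps_map \o @fps_of_poly R)).
  by rewrite map_poly_comp horner_map PF0 rmorph0.
by move=> p /=; rewrite fps_map_of_poly.
Qed.

End PowerSeries.

Lemma coefs_sum (R : comNzRingType) I (r : seq I) (P : pred I) (F : I -> fps R) n :
  coefs (\sum_(i <- r | P i) F i) n = \sum_(i <- r | P i) coefs (F i) n.
Proof. by elim/big_rec2: _ => // i x y _ <-. Qed.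

(** A root of [P] whose reduction mod [p] vanishes is also a root of [P / p],
    because power series over the integers have no [p]-torsion; this descent
    terminates since it shrinks any fixed nonzero coefficient of [P]. *)
Lemma root_reduction p (F : fps int) (P : {poly {poly int}}) : prime p ->
    P != 0 -> root (map_poly (@fps_of_poly int) P) F ->
  exists2 Q : {poly {poly int}}, root (map_poly (@fps_of_poly int) Q) F &
    map_poly (map_poly (intr : int -> 'F_p)) Q != 0.
Proof.
move=> pr_p nzP.
have [i [j nzc]] : exists i, exists j, P`_i`_j != 0.
  exists (size P).-1, (size (lead_coef P)).-1.
  by rewrite -!lead_coefE !lead_coef_eq0.
have [n] := ubnP (absz P`_i`_j); elim: n => // n IHn in P nzc {nzP} *.
rewrite ltnS => le_n PF.
have [P0|] := eqVneq (map_poly (map_poly (intr : int -> 'F_p)) P) 0; last by exists P.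
pose Q := map_poly (map_poly (fun c => (c %/ p)%Z)) P.
have QE k l : Q`_k`_l = (P`_k`_l %/ p)%Z.
  by rewrite coef_map_id0 ?coef_map_id0 ?div0z // map_poly0.
have pP k l : P`_k`_l = p%:Z * Q`_k`_l.
  rewrite QE mulrC; apply/esym/eqP; rewrite -dvdz_eq.
  have : (map_poly (map_poly (intr : int -> 'F_p)) P)`_k`_l = 0 by rewrite P0 !coef0.
  by rewrite !coef_map /= => /eqP; rewrite (dvdz_pcharf (pchar_Fp pr_p)).
have p1 := prime_gt1 pr_p.
have nzQ : Q`_i`_j != 0 by apply: contraNneq nzc => Q0; rewrite pP Q0 mulr0.
apply: (IHn Q nzQ).
  apply: leq_trans le_n; rewrite pP abszM /= ltn_Pmull // absz_gt0 //.
have PQ : P = p%:R * Q.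
  apply/polyP=> k; apply/polyP=> l; rewrite pP mulr_natl !coefMn.
  by rewrite mulrC -mulr_natr natz.
move: PF; rewrite PQ rmorphM rmorph_nat /= !rootE hornerM -polyC_natr hornerC.
move=> /eqP pF0; apply/eqP/fpsP => k.
have := congr1 (fun G => coefs G k) pF0; rewrite mulr_natl.
have coefMn_fps (G : fps int) m : coefs (G *+ m) k = coefs G k *+ m.
  by elim: m => [|m IH]; rewrite ?mulr0n // !mulrS -IH.
rewrite coefMn_fps /= => /eqP; rewrite mulrn_eq0 eqn0Ngt (ltnW p1) /=.
by move/eqP.
Qed.

(** * Linear dependence modulo a polynomial *)

Lemma frac_num_den (A : idomainType) (x : {fraction A}) :
  exists n d : A, d != 0 /\ tofrac d * x = tofrac n.
Proof.
elim/quotW: x => y; exists (\n_y), (\d_y); split; first exact: denom_ratioP.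
rewrite /GRing.mul /=.
unlock FracField.tofrac.
rewrite !piE.
apply/eqP; rewrite piE /FracField.mulf.
by rewrite FracField.equivfE !numden_Ratio ?oner_eq0 ?mul1r ?denom_ratioP // mulr1 mulrC.
Qed.

(** Over the fraction field this is the rank inequality; multiplying a kernel
    vector by all its denominators brings it back to [A]. *)
Lemma exists_left_kernel (A : idomainType) m n (M : 'M[A]_(m, n)) :
  (n < m)%N -> exists2 u : 'rV[A]_m, u != 0 & u *m M = 0.
Proof.
move=> lt_nm; pose MF := map_mx (@tofrac A) M.
have : kermx MF != 0.
  by rewrite kermx_eq0 /row_free neq_ltn (leq_ltn_trans (rank_leq_col MF)).
case/rowV0Pn=> v /sub_kermxP vM0 nzv.
have [num [den numP]] : exists num den : 'I_m -> A,
    forall i, den i != 0 /\ tofrac (den i) * v 0 i = tofrac (num i).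
  have [num numP] := boolp.choice (fun i => frac_num_den (v 0 i)).
  by have [den denP] := boolp.choice numP; exists num, den.
pose d := \prod_i den i.
have nzd : d != 0 by apply/prodf_neq0=> i _; case: (numP i).
pose u := \row_i (num i * \prod_(j | j != i) den j).
have uE : map_mx (@tofrac A) u = tofrac d *: v.
  apply/rowP=> i; rewrite !mxE /d [in RHS](bigD1 i) //= !rmorphM /=.
  by rewrite [RHS]mulrAC (proj2 (numP i)).
exists u.
  apply: contraNneq nzv => u0; move: uE; rewrite u0 raddf0.
  by move/esym/eqP; rewrite scaler_eq0 tofrac_eq0 (negPf nzd).
apply/matrixP=> i j; rewrite [RHS]mxE; apply/eqP; rewrite -tofrac_eq0; apply/eqP.
have := congr1 (fun N : 'M_(1, n) => N i j) (map_mxM (@tofrac A) u M).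
by rewrite [LHS]mxE uE -scalemxAl vM0 scaler0 [RHS]mxE.
Qed.

(** The pseudo-remainders of the [size P] monomials modulo [P] lie in a module
    of rank [(size P).-1], so they satisfy a nontrivial linear relation; the
    powers of the leading coefficient introduced by pseudo-division are absorbed
    in the coefficients of the relation. *)
Lemma dependent_powers (A : idomainType) (P : {poly A}) (e : nat -> nat) :
  P != 0 -> exists c : 'I_(size P) -> A,
    (exists i, c i != 0) /\ (exists Q, \sum_i c i *: 'X^(e i) = Q * P).
Proof.
move=> nzP; pose r i := 'X^(e i) %% P.
pose M := \matrix_(i < size P, j < (size P).-1) (r i)`_j.
have szP : (0 < size P)%N by rewrite size_poly_gt0.
have [|u nzu uM0] := @exists_left_kernel _ _ _ M; first by rewrite prednK.
pose s i := lead_coef P ^+ scalp 'X^(e i) P.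
exists (fun i => u 0 i * s i); split.
  have /rV0Pn[i nzi] := nzu; exists i.
  by rewrite mulf_neq0 // expf_neq0 // lead_coef_eq0.
have rem0 : \sum_i u 0 i *: r i = 0.
  apply/polyP=> j; rewrite coef_sum coef0.
  have [lt_j|le_j] := ltnP j (size P).-1.
    have := congr1 (fun N : 'rV_ _ => N 0 (Ordinal lt_j)) uM0.
    by rewrite !mxE => uM0j; rewrite -[RHS]uM0j; apply: eq_bigr => i _; rewrite coefZ mxE.
  rewrite big1 // => i _; rewrite coefZ nth_default ?mulr0 //.
  by rewrite (leq_trans _ le_j) // -ltnS prednK // ltn_modp.
exists (\sum_i u 0 i *: ('X^(e i) %/ P)); rewrite mulr_suml -[RHS]addr0 -[X in _ + X]rem0.
rewrite -big_split /=; apply: eq_bigr => i _.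
by rewrite -scalerA Pdiv.Idomain.divp_eq scalerDr scalerAl.
Qed.

(** * Frobenius and algebraic series over a prime field *)

Lemma coefs_exp_trunc (R : comNzRingType) (F : fps R) k n i :
  (i <= n)%N -> coefs (F ^+ k) i = (fps_trunc n.+1 F ^+ k)`_i.
Proof.
elim: k i => [|k IHk] i le_in; first by rewrite !expr0 coef1.
rewrite !exprS; apply: coefs_mul_trunc => j le_ji; have le_jn := leq_trans le_ji le_in.
  by rewrite coef_fps_trunc.
by rewrite IHk.
Qed.

(** Raising to the power [p ^ i] is additive in characteristic [p] and fixes
    the coefficients, which lie in the prime field. *)
Lemma poly_Fp_exp p i (q : {poly 'F_p}) : prime p -> q ^+ (p ^ i) = q \Po 'X^(p ^ i).
Proof.
move=> pr_p.
have cE (c : 'F_p) : c ^+ (p ^ i) = c.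
  elim: i => [|i IHi]; first by rewrite expr1.
  by rewrite expnSr exprM IHi -[in X in _ ^+ X](card_Fp pr_p) expf_card.
have pX : [pchar {poly 'F_p}].-nat (p ^ i)%N.
  by rewrite pnatX pnatE // pchar_poly pchar_Fp.
elim/poly_ind: q => [|q c IHq]; first by rewrite comp_poly0 expr0n expn_eq0 eqn0Ngt prime_gt0.
by rewrite exprDn_pchar // exprMn IHq comp_poly_MXaddC -polyC_exp cE.
Qed.

Lemma coefs_Fp_exp p i (F : fps 'F_p) n : prime p ->
  coefs (F ^+ (p ^ i)) n = if (p ^ i %| n)%N then coefs F (n %/ p ^ i) else 0.
Proof.
move=> pr_p; rewrite (coefs_exp_trunc _ _ (leqnn n)) poly_Fp_exp //.
rewrite coef_comp_poly_Xn ?expn_gt0 ?prime_gt0 //.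
by rewrite coef_fps_trunc // ltnS leq_div.
Qed.

(** The relation of [dependent_powers] between the powers [G ^+ (p ^ i)], read
    coefficientwise: by [coefs_Fp_exp] these powers only spread out the
    coefficients of [G]. *)
Lemma frobenius_relation p (G : fps 'F_p) (P : {poly {poly 'F_p}}) : prime p ->
    P != 0 -> root (map_poly (@fps_of_poly _) P) G ->
  exists d (c : 'I_d -> {poly 'F_p}), (exists i, c i != 0) /\
    forall n, \sum_(i < d) \sum_(j < n.+1 | (p ^ i %| n - j)%N)
      (c i)`_j * coefs G ((n - j) %/ p ^ i) = 0.
Proof.
move=> pr_p nzP /rootP PG0.
have [c [nzc [Q eqQ]]] := dependent_powers (fun i => p ^ i)%N nzP.
exists (size P), c; split=> // n.
have : (map_poly (@fps_of_poly _) (\sum_i c i *: 'X^(p ^ i))).[G] = 0.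
  by rewrite eqQ rmorphM hornerM PG0 mulr0.
rewrite rmorph_sum horner_sum => /(congr1 (fun H => coefs H n)).
rewrite coefs_sum /= => sum0; rewrite -[RHS]sum0; apply: eq_bigr => i _.
rewrite map_polyZ map_polyXn hornerZ hornerXn big_mkcond.
apply: eq_bigr => j _ /=; rewrite coefs_Fp_exp //.
by case: ifP; rewrite ?mulr0.
Qed.

(** * Squarefree numbers in arithmetic progressions *)

(** Two solutions in the same block of [d] consecutive indices would be
    congruent modulo [d], hence equal; so each block contains at most one. *)
Lemma card_dvd_progression Q a d N : (0 < d)%N -> coprime d Q ->
  (#|[set n : 'I_N | d %| Q * n + a]| <= (N %/ d).+1)%N.
Proof.
move=> d_gt0 coQ; set A := [set _ | _].
pose block (n : 'I_N) : 'I_(N %/ d).+1 := inord (n %/ d).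
rewrite -[X in (_ <= X)%N]card_ord; apply: (@leq_card_in _ _ block) => m n.
have blockE (k : 'I_N) : block k = (k %/ d)%N :> nat.
  by rewrite inordK // ltnS leq_div2r // ltnW.
rewrite !inE => dm dn /(congr1 val); rewrite /= !blockE => eq_mn.
apply/val_inj => /=; rewrite (divn_eq m d) (divn_eq n d) eq_mn; congr (_ + _)%N.
have : (Q * m + a == Q * n + a %[mod d])%N by rewrite (eqP dm) (eqP dn).
rewrite eqn_modDr => mn; have : (m == n %[mod d])%N.
  wlog le_nm : m n mn {dm dn eq_mn} / (n <= m)%N => [th|].
    have [/(th m n mn)//|/ltnW le_mn] := leqP n m.
    by rewrite eq_sym th // eq_sym.
  by move: mn; rewrite !eqn_mod_dvd ?leq_mul2l ?le_nm ?orbT // -mulnBr Gauss_dvdr.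
by move/eqP.
Qed.

(** Telescoping: [(l + 1)^-2] is at most [l^-1 - (l + 1)^-1]. *)
Lemma sum_inv_sq_le (L : nat) : (2 <= L)%N ->
  \sum_(3 <= l < L.+1) (l%:R ^+ 2)^-1 <= 2%:R^-1 - L%:R^-1 :> rat.
Proof.
elim: L => [//|L IHL]; rewrite leq_eqVlt => /predU1P[<-|].
  by rewrite (big_geq (leqnn 3)) subrr.
rewrite ltnS => L2; rewrite big_nat_recr //=.
apply: le_trans (lerD (IHL L2) (lexx _)) _.
have L0 : 0 < L%:R :> rat by rewrite ltr0n; lia.
rewrite -addrA lerD2l -natr1; move: (L%:R) L0 => x x0.
have -> : - x^-1 = - (x + 1)^-1 - (x * (x + 1))^-1 by field; lra.
rewrite -addrA gerDl addrC subr_le0 lef_pV2 ?posrE; nra.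
Qed.

Lemma sum_div_sq_le (N L : nat) : (2 * (\sum_(3 <= l < L) N %/ l ^ 2) <= N)%N.
Proof.
case: L => [|L]; first by rewrite big_geq.
have [L2|L2] := leqP 2 L; last by rewrite big_geq //; lia.
rewrite -(ler_nat rat) natrM natr_sum mulrC -ler_pdivlMr //.
have : \sum_(3 <= l < L.+1) (N %/ l ^ 2)%:R
       <= N%:R * (\sum_(3 <= l < L.+1) (l%:R ^+ 2)^-1) :> rat.
  rewrite mulr_sumr; apply: ler_sum_nat => l /andP[l3 _].
  have l0 : 0 < l%:R ^+ 2 :> rat by rewrite exprn_gt0 // ltr0n; lia.
  by rewrite ler_pdivlMr // -natrX -natrM ler_nat leq_divM.
move/le_trans; apply.
have s2 : \sum_(3 <= l < L.+1) (l%:R ^+ 2)^-1 <= 2%:R^-1 :> rat.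
  by rewrite (le_trans (sum_inv_sq_le L2)) // gerBl invr_ge0.
by rewrite ler_wpM2l.
Qed.

(** A counting sieve.  Among the first [N = 16 Q] terms, all below [16 Q ^ 2], a
    term that is not squarefree is divisible by [l ^ 2] for a prime [l] below
    [4 Q]; such an [l] is prime to [Q], hence at least 3.  Summing
    [N / l ^ 2 + 1] over [l] bounds the number of these terms by
    [8 Q + 4 Q < N]. *)
Lemma squarefree_in_progression Q a : (2 %| Q)%N -> (a < Q)%N -> coprime a Q ->
  exists n, moebius (Q * n + a) != 0.
Proof.
move=> Q2 aQ coaQ; apply/not_existsP => all0.
have Q_gt0 : (0 < Q)%N by lia.
pose N := (16 * Q)%N; pose L := (4 * Q)%N.
pose A l := [set n : 'I_N | l ^ 2 %| Q * n + a]%N.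
(* Under [all0], [cover] says that the sets [A l] cover the index range. *)
have cover (n : 'I_N) : exists l : 'I_L, [&& prime l, (3 <= l)%N, coprime l Q & n \in A l].
  have := all0 n => /negP; rewrite negbK /moebius.
  have m_gt0 : (0 < Q * n + a)%N.
    by rewrite addn_gt0 orbC lt0n; case: eqP coaQ => // ->; rewrite /coprime gcd0n; lia.
  case: hasP => [[l]|_]; last by rewrite expf_eq0 oppr_eq0 oner_eq0 andbF.
  rewrite mem_primes => /and3P[pr_l _ l_n] l2 _.
  have co_l : coprime l Q.
    rewrite prime_coprime //; apply/negP => lQ.
    have : (l %| gcdn a Q)%N by rewrite dvdn_gcd lQ -(dvdn_addr _ (dvdn_mulr n lQ)) l_n.
    by rewrite (eqP coaQ) dvdn1; case: eqP pr_l => // ->.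
  have lt_lL : (l < L)%N.
    have := dvdn_leq m_gt0 l2; have := ltn_ord n; rewrite /N /L; nia.
  exists (Ordinal lt_lL); rewrite /= pr_l co_l inE l2 /= andbT.
  have := prime_gt1 pr_l; case: (l =P 2) co_l => [->|]; last by lia.
  by rewrite prime_coprime // Q2.
pose good (l : nat) := (3 <= l)%N && coprime l Q.
have le_N : (N <= \sum_(l < L | good l) #|A l|)%N.
  under eq_bigr => l _ do rewrite -sum1dep_card.
  rewrite (exchange_big_dep xpredT) //= -[X in (X <= _)%N](card_ord N) -sum1_card.
  apply: leq_sum => n _; have [l /and4P[_ l3 col nl]] := cover n.
  by rewrite (bigD1 l) //= /good l3 col /=; rewrite inE in nl.
have : (\sum_(l < L | good l) #|A l| <= \sum_(3 <= l < L) (N %/ l ^ 2).+1)%N.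
  rewrite -(big_mkord good (fun l => #|A l|)) (big_cat_nat (n := 3)) //=; last by rewrite /L; lia.
  rewrite [X in (X + _)%N]big1_seq ?add0n; last first.
    by move=> l; rewrite mem_index_iota /good; lia.
  rewrite big_mkcond /=; apply: leq_sum => l _; case: ifP => // /andP[l3 col].
  by rewrite card_dvd_progression ?expn_gt0 ?coprimeXl //; lia.
move/(leq_trans le_N); apply/negP; rewrite -ltnNge.
under eq_bigr => l _ do rewrite -addn1.
rewrite big_split sum_nat_const_nat /= muln1.
have := sum_div_sq_le N L; rewrite /N /L; lia.
Qed.

(** * Isolating one term of the relation *)

Lemma exists_eqn_mod c d t : (0 < c)%N -> coprime c d -> exists r, c * r = t %[mod d].
Proof.
move=> c_gt0 co_cd; exists (chinese c d 0 t %/ c)%N.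
rewrite mulnC divnK; first exact: chinese_modr.
by rewrite /dvdn chinese_modl // mod0n.
Qed.

Lemma eqn_mod_dvdm m n d e : (d %| e)%N -> m = n %[mod e] -> m = n %[mod d].
Proof. by move=> de eq_mn; rewrite -(modn_dvdm m de) eq_mn modn_dvdm. Qed.

(** One new prime [p], larger than [Q] and all the indices, is added for each
    [j].  The residue [a] stays coprime to the modulus: if [p] divided [a], then
    [j0] and [j] would be congruent modulo [p], although both are smaller than
    [p]. *)
Lemma crt_residues c j0 J B : (j0 <= B)%N -> (J <= B.+1)%N -> exists Q a,
  [/\ (2 %| Q)%N, (a < Q)%N, coprime a Q &
   forall j, (j < J)%N -> j != j0 -> exists p,
     [/\ prime p, odd p, (p ^ 2 %| Q)%N & (2 ^ c * a + j0)%N = j %[mod p ^ 2]]].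
Proof.
move=> j0B; elim: J => [_|J IH JB]; first by exists 2, 1.
have [Q [a [Q2 aQ coaQ sq]]] := IH (ltnW JB).
have [eq_J|neq_J] := eqVneq J j0.
  exists Q, a; split=> // j; rewrite ltnS leq_eqVlt => /predU1P[->|]; last exact: sq.
  by rewrite eq_J eqxx.
have [p] := prime_above (Q + B); set q := (p ^ 2)%N => lt_p pr_p.
have [lt_Jp lt_j0p] : (J < p)%N /\ (j0 < p)%N by lia.
have co_p b : (0 < b)%N -> (b < p)%N -> coprime q b.
  move=> b0 bp; rewrite coprimeXl // prime_coprime //.
  by apply/negP => /(dvdn_leq b0); lia.
have q0 : (0 < q)%N by rewrite expn_gt0 prime_gt0.
have Q_ge2 : (2 <= Q)%N by apply: dvdn_leq => //; lia.
have coQq : coprime Q q by rewrite coprime_sym co_p //; lia.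
have co2q : coprime (2 ^ c) q by rewrite coprimeXl // coprime_sym co_p //; lia.
have [r rE] := exists_eqn_mod (J + q.-1 * j0) (expn_gt0 2 c) co2q.
(* Modulo [q], the number [J + q.-1 * j0] is [J - j0]. *)
pose a' := (chinese Q q a r %% (Q * q))%N.
have a'Q : a' = a %[mod Q] by rewrite modn_dvdm ?dvdn_mulr // chinese_modl.
have a'q : a' = r %[mod q] 
  by rewrite (modn_dvdm _ (dvdn_mull Q (dvdnn q))); apply: chinese_modr.
have a'J : (2 ^ c * a' + j0)%N = J %[mod q].
  rewrite -modnDml -modnMmr a'q modnMmr rE modnDml -addnA -mulSnr prednK //.
  by rewrite addnC mulnC modnMDl.
exists (Q * q)%N, a'; split.
- by rewrite dvdn_mulr.
- by rewrite ltn_mod muln_gt0 q0 (ltnW Q_ge2).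
- rewrite coprimeMr -coprime_modl a'Q coprime_modl coaQ /=.
  rewrite coprimeXr // coprime_sym prime_coprime //; apply/negP => pa'.
  have /(eqn_mod_dvdm _) := a'J => /(_ p (dvdn_exp _ (dvdnn p))).
  rewrite -modnDml (eqP (dvdn_mull (2 ^ c) pa')) add0n.
  rewrite !modn_small //.
  by move=> /(_ isT) eq_j0J; rewrite eq_j0J eqxx in neq_J.
move=> j; rewrite ltnS leq_eqVlt => /predU1P[->|lt_jJ] neq_j.
  exists p; split=> //; last by rewrite dvdn_mull.
  by have /even_prime[p2|//] := pr_p; move: lt_p; rewrite p2 ltnNge (leq_trans Q_ge2) ?leq_addr.
have [l [pr_l odd_l lQ lE]] := sq j lt_jJ neq_j; exists l; split=> //.
  exact: dvdn_mulr.
by rewrite -lE -modnDml -modnMmr (eqn_mod_dvdm lQ a'Q) modnMmr modnDml.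
Qed.

(** With this choice of [n], the number [n - j0] is exactly divisible by
    [2 ^ i0] with a squarefree quotient, while [n] is congruent to every other
    [j] below [J] modulo the square of an odd prime. *)
Lemma isolating_index i0 j0 J : exists n m : nat,
  [/\ n = (2 ^ i0 * m + j0)%N, odd m, moebius m != 0 &
   forall j, (j < J)%N -> j != j0 ->
     exists p, [/\ prime p, odd p & n = j %[mod p ^ 2]]].
Proof.
have [|| Q [a [Q2 aQ coaQ sq]]] := @crt_residues i0 j0 J (j0 + J); try lia.
have [k nz_k] := squarefree_in_progression Q2 aQ coaQ.
exists (2 ^ i0 * (Q * k + a) + j0)%N, (Q * k + a)%N; split=> //.
  have := coprime_dvdr Q2 coaQ; rewrite coprimen2 => odd_a.
  by rewrite oddD oddM odd_a; move: Q2; rewrite dvdn2 => /negPf ->.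
move=> j lt_jJ neq_j; have [p [pr_p odd_p pQ pE]] := sq j lt_jJ neq_j.
exists p; split=> //.
have termE : (Q * k + a)%N = a %[mod p ^ 2].
  by rewrite -modnDml (eqP (dvdn_mulr k pQ)) add0n.
by rewrite -pE -modnDml -modnMmr termE modnMmr modnDml.
Qed.

(** * The Moebius series *)

Lemma moebius_series_mod2_sq m p : prime p -> (p ^ 2 %| m)%N ->
  coefs (fps_map (intr : {rmorphism int -> 'F_2}) moebius_series) m = 0.
Proof.
by move=> pr_p pm /=; case: ifP => // m0; rewrite (moebius_sq m0 pr_p pm).
Qed.

Lemma moebius_series_mod2_neq0 m : (0 < m)%N -> moebius m != 0 ->
  coefs (fps_map (intr : {rmorphism int -> 'F_2}) moebius_series) m != 0.
Proof.
move=> m0 /=; rewrite m0 /moebius; case: ifP => // _ _.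
by rewrite rmorph_sign signr_eq0.
Qed.

Theorem corollary2 : transcendentalOver (@fps_of_poly int) moebius_series.
Proof.
move=> P nzP PF0.
have pr2 : prime 2 by [].
have [Q QF0 nzQ] := root_reduction pr2 nzP PF0.
pose red : {rmorphism int -> 'F_2} := intr.
have /(frobenius_relation pr2 nzQ)[d [c [[i1 nz1] rel]]] := fps_map_root red QF0.
set G := fps_map red moebius_series in rel.
case: (@arg_minnP _ i1 (fun i => c i != 0) (fun i => i : nat) nz1) => i0 nz0 min0.
pose j0 := (size (c i0)).-1; pose J := \max_i size (c i).
have [n [m [nE odd_m nz_m sq]]] := isolating_index i0 j0 J.
have vanish (i : 'I_d) (j : 'I_n.+1) : (2 ^ i %| n - j)%N ->
    (i != i0) || (j != j0 :> nat) -> (c i)`_j * coefs G ((n - j) %/ 2 ^ i) = 0.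
  move=> dvd_i neq.
  have [cij0|nz_ij] := eqVneq (c i)`_j 0; first by rewrite cij0 mul0r.
  have lt_jJ : (j < J)%N.
    apply: leq_trans (leq_bigmax i); rewrite ltnNge.
    by apply: contra nz_ij => le_j; rewrite nth_default.
  have le_i : (i0 <= i)%N by apply: min0; apply: contraNneq nz_ij => ->; rewrite coef0.
  (* For [j = j0] the index [i] exceeds [i0], and [2 ^ i] cannot divide
     [n - j0 = 2 ^ i0 * m] with [m] odd; otherwise an odd prime square divides
     [n - j], and it survives the division by [2 ^ i]. *)
  have [eq_j|neq_j] := eqVneq (j : nat) j0.
    move: neq; rewrite eq_j eqxx orbF => neq_i.
    have lt_i : (i0 < i)%N by rewrite ltn_neqAle le_i andbT eq_sym.
    move: dvd_i; rewrite eq_j nE addnK => /(dvdn_trans (dvdn_exp2l 2 lt_i)).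
    by rewrite expnSr dvdn_pmul2l ?expn_gt0 // dvdn2 odd_m.
  have [p [pr_p odd_p /eqP n_j]] := sq j lt_jJ neq_j.
  have p2 : (p ^ 2 %| (n - j) %/ 2 ^ i)%N.
    move: n_j; rewrite eqn_mod_dvd -1?ltnS // -{1}(divnK dvd_i) Gauss_dvdl //.
    by rewrite coprimeXl // coprimeXr // coprimen2.
  by rewrite [coefs G _](moebius_series_mod2_sq pr_p p2) mulr0.
have lt_j0 : (j0 < n.+1)%N by rewrite ltnS nE leq_addl.
have dvd0 : (2 ^ i0 %| n - j0)%N by rewrite nE addnK dvdn_mulr.
have := rel n; rewrite (bigD1 i0) //= (bigD1 (Ordinal lt_j0)) //= [X in _ + X]big1.
  rewrite big1 ?addr0; last first.
    by move=> j /andP[dvd_j neq_j]; apply: vanish => //; rewrite neq_j orbT.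
  move/eqP; apply/negP; rewrite mulf_neq0 //; first by rewrite -lead_coefE lead_coef_eq0.
  rewrite nE addnK mulKn ?expn_gt0 //.
  exact: moebius_series_mod2_neq0 (odd_gt0 odd_m) nz_m.
move=> i neq_i; rewrite big1 // => j dvd_j.
by apply: vanish => //; rewrite neq_i.
Qed.
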